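(* Let $n\ge 1$ and let $f_i(x) = a_i x + b_i$, for $i = 1, \ldots, n$, be affine maps of $\mathbb{R}$ where each $a_i$ is a positive integer and each $b_i \in \mathbb{Q}$. If $$\frac{1}{a_1} + \cdots + \frac{1}{a_n} > 1,$$ then the semigroup $S = \langle f_1, \ldots, f_n\rangle$ is not free with free basis $f_1,\dots,f_n$; that is, there exist two distinct finite nonempty sequences of indices $(i_1,\dots,i_k)$ and $(j_1,\dots,j_l)$ in $\{1,\dots,n\}$ with $f_{i_1}\circ\cdots\circ f_{i_k} = f_{j_1}\circ\cdots\circ f_{j_l}$.
   Context: $\langle f_1,\dots,f_n\rangle$ denotes the semigroup generated by $f_1,\dots,f_n$ under composition of maps $\mathbb{R}\to\mathbb{R}$. *)

(* Defs.v *)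
From HB Require Import structures.
From mathcomp Require Import all_boot all_order all_algebra.
From mathcomp Require Import reals.

Set Implicit Arguments.
Unset Strict Implicit.
Unset Printing Implicit Defensive.

Section SemigroupOfMaps.
Variables (T : Type) (n : nat) (f : 'I_n -> T -> T).

Inductive gen_semigroup : (T -> T) -> Prop :=
| gen_semigroup_gen i : gen_semigroup (f i)
| gen_semigroup_comp g h :
    gen_semigroup g -> gen_semigroup h -> gen_semigroup (g \o h).

(* f_{i_1} \o ... \o f_{i_k} for the word w = [:: i_1; ...; i_k]; the empty
   word gives the identity, which need not lie in gen_semigroup. *)
Definition word_comp (w : seq 'I_n) : T -> T :=
  foldr (fun i g => f i \o g) id w.

(* Semigroups, not monoids: only nonempty words are factorizations. *)
Definition free_basis : Prop :=
  forall g, gen_semigroup g ->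
    exists! w : seq 'I_n, w <> [::] /\ word_comp w = g.

End SemigroupOfMaps.

(* Main.v *)
Require Import Defs.
From HB Require Import structures.
From mathcomp Require Import all_boot all_order all_algebra.
From mathcomp Require Import boolp reals.
From mathcomp Require Import zify lra.

(** A word [w] of length [k] acts as [x |-> A x + B] with [A] the product of
    its slopes. With a common denominator [D] of the [b_i], the number [D B] is
    an integer with [|D B| <= M k A], so if all words of length [k] acted
    differently, at most [(2 M k + 1) A] of them would share a given letter
    count (which determines [A]). There are at most [(k + 1)^n] letter counts,
    hence the sum of [1 / A] over all words of length [k] would be at most
    [(2 M k + 1) (k + 1)^n]. But this sum is [(\sum_i 1 / a_i)^k], which grows
    exponentially. *)

Set Implicit Arguments.
Unset Strict Implicit.
Unset Printing Implicit Defensive.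

Import Order.TTheory GRing.Theory Num.Theory.
Local Open Scope ring_scope.

Lemma bernoulli_le (R : realDomainType) (h : R) (m : nat) :
  0 <= h -> 1 + m%:R * h <= (1 + h) ^+ m.
Proof.
move=> h0; elim: m => [|m IH]; first by rewrite mul0r addr0 expr0.
rewrite exprS -natr1.
apply: (@le_trans _ _ ((1 + h) * (1 + m%:R * h))).
  have : 0 <= m%:R * h * h by rewrite !mulr_ge0.
  by nra.
by rewrite ler_wpM2l // addr_ge0.
Qed.

(** With [h = l - 1], Bernoulli gives [l ^+ m >= m h], so the exponent [m * d.+1] yields at least
    [(m h) ^+ d.+1], of degree [d.+1] in [m] against degree [d] on the left. *)
Lemma exp_gt_poly (R : archiRealFieldType) (l C : R) (d : nat) :
  1 < l -> 0 <= C -> exists k : nat, C * k.+1%:R ^+ d < l ^+ k.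
Proof.
move=> l1 C0; pose h := l - 1.
have h0 : 0 < h by rewrite subr_gt0.
(* For [m > K], [(m h) ^+ d.+1] exceeds [C (2 (d + 1) m) ^+ d]; the factor 2 absorbs the successor
   in [k.+1], where [k = m (d + 1)]. *)
pose K := C * (2 * d.+1)%:R ^+ d / h ^+ d.+1.
have K0 : 0 <= K by rewrite !mulr_ge0 ?invr_ge0 ?exprn_ge0 // ltW.
pose m := (Num.bound K).
have Km : K < m%:R by have := archi_boundP K0.
have m0 : (0 < m)%N by rewrite -(ltr_nat R); apply: le_lt_trans Km.
have m0' : (0 : R) < m%:R by rewrite ltr0n.
exists (m * d.+1)%N.
apply: (@lt_le_trans _ _ ((m%:R * h) ^+ d.+1)); last first.
  rewrite exprM lerXn2r ?nnegrE ?exprn_ge0 ?mulr_ge0 ?(ltW h0) //.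
    by rewrite (le_trans ler01) // ltW.
  have := bernoulli_le m (ltW h0); rewrite [1 + h]addrC subrK => H.
  by apply: le_trans H; rewrite lerDr.
apply: (@le_lt_trans _ _ (C * (2 * d.+1)%:R ^+ d * m%:R ^+ d)).
  rewrite -mulrA ler_wpM2l // -exprMn lerXn2r ?nnegrE ?mulr_ge0 //.
  by rewrite -natrM ler_nat; nia.
rewrite exprMn exprS [X in _ < X]mulrAC ltr_pM2r ?exprn_gt0 //.
by rewrite -ltr_pdivrMr ?exprn_gt0.
Qed.

Lemma common_denominator (n : nat) (b : 'I_n -> rat) :
  exists (D : rat) (c : 'I_n -> int),
    D != 0 /\ forall i, b i * D = (c i)%:~R.
Proof.
exists (\prod_i (denq (b i))%:~R).
exists (fun i => numq (b i) * \prod_(j | j != i) denq (b j)); split.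
  by apply/prodf_neq0 => i _; rewrite intr_eq0 denq_neq0.
move=> i; rewrite (bigD1 i) //= mulrA -{1}(divq_num_den (b i)) divfK.
  by rewrite intrM rmorph_prod.
by rewrite intr_eq0 denq_neq0.
Qed.

Section Words.
Variables (n : nat) (a : 'I_n -> nat) (c : 'I_n -> int).
Hypothesis a_gt0 : forall i, (0 < a i)%N.

Definition word_slope (w : seq 'I_n) : nat := (\prod_(i <- w) a i)%N.

(** Horner form of the constant term of the composite map, scaled by the common denominator [D]:
    [c i] will be [b i * D]. *)
Definition word_const (w : seq 'I_n) : int :=
  foldr (fun i x => c i + (a i)%:Z * x) 0 w.

Definition max_const : nat := (\max_i `|c i|)%N.

Lemma word_slope_gt0 w : (0 < word_slope w)%N.
Proof. by rewrite /word_slope; apply: prodn_gt0. Qed.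

(** By induction: each new letter adds at most one [max_const], which is at most [max_const] times
    the new slope because slopes are at least 1. *)
Lemma word_const_bound w :
  (`|word_const w| <= max_const * size w * word_slope w)%N.
Proof.
rewrite /word_slope; elim: w => [|i w IH]; first by rewrite big_nil.
rewrite big_cons /=.
have ci : (`|c i| <= max_const)%N by rewrite /max_const (bigD1 i) //= leq_maxl.
have ai := a_gt0 i; have := word_slope_gt0 w; rewrite /word_slope.
move: IH; move: (\prod_(j <- w) a j)%N (word_const w) => A B IH A0.
have : (`|(c i + (a i)%:Z * B)%R| <= `|c i| + a i * `|B|)%N.
  by have := abszM (a i) B; lia.
have : (a i * `|B| <= a i * (max_const * size w * A))%N by rewrite leq_mul2l IH orbT.
have : (max_const <= max_const * (a i * A))%N by rewrite leq_pmulr // muln_gt0 ai.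
by nia.
Qed.

Lemma word_const_shift w :
  (`|(word_const w + (max_const * size w * word_slope w)%:Z)%R|
     < (2 * (max_const * size w * word_slope w)).+1)%N.
Proof. by have := word_const_bound w; lia. Qed.

Section Counting.
Variable k : nat.

Let word := {ffun 'I_k -> 'I_n}.

(** Counts are at most [k], so [inord] loses nothing, and the finite type of values has [k.+1 ^ n]
    elements. *)
Definition letter_count (w : word) : {ffun 'I_n -> 'I_k.+1} :=
  [ffun i => inord (count_mem i (codom w))].

Lemma size_word (w : word) : size (codom w) = k.
Proof. by rewrite size_codom card_ord. Qed.

Lemma letter_count_perm (w v : word) :
  letter_count w = letter_count v -> perm_eq (codom w) (codom v).
Proof.
move=> e; apply/allP => i _ /=; apply/eqP.
move/ffunP/(_ i): e; rewrite !ffunE => /(congr1 val) /=.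
have lt_count (u : word) : (count_mem i (codom u) < k.+1)%N.
  by rewrite ltnS (leq_trans (count_size _ _)) ?size_word.
by rewrite !inordK.
Qed.

Hypothesis separated : forall w v : word,
  perm_eq (codom w) (codom v) ->
  word_const (codom w) = word_const (codom v) -> w = v.

Lemma card_letter_class (w0 : word) :
  (#|[set w | letter_count w == letter_count w0]|
     <= (2 * (max_const * k)).+1 * word_slope (codom w0))%N.
Proof.
pose N := (max_const * k * word_slope (codom w0))%N.
(* On the class of [w0], adding [N] moves the constants into [[0, 2N]], so neither [absz] nor
   [inord] merges two of them. *)
pose g (w : word) : 'I_(2 * N).+1 := inord (absz (word_const (codom w) + N%:Z)).
have gP w : letter_count w = letter_count w0 ->
  [/\ perm_eq (codom w) (codom w0), (`|word_const (codom w)| <= N)%N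
    & (`|(word_const (codom w) + N%:Z)%R| < (2 * N).+1)%N].
  move=> /letter_count_perm pw.
  have := word_const_shift (codom w); have := word_const_bound (codom w).
  have e : word_slope (codom w) = word_slope (codom w0) by apply: perm_big.
  by rewrite size_word e.
have ginj : {in [set w | letter_count w == letter_count w0] &, injective g}.
  move=> w v; rewrite !inE => /eqP/gP[pw bw lw] /eqP/gP[pv bv lv].
  move/(congr1 val); rewrite /= !inordK // => e.
  apply: separated; first by rewrite (perm_trans pw) // perm_sym.
  by lia.
rewrite -(card_in_imset ginj).
apply: (leq_trans (max_card _)); rewrite card_ord /N.
(* A slope [A >= 1] absorbs the successor: [2 M k A + 1 <= (2 M k + 1) A], with [M = max_const]. *)
by have := word_slope_gt0 (codom w0); nia.
Qed.

Lemma separated_growth (R : realFieldType) :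
  (\sum_(i < n) ((a i)%:R : R)^-1) ^+ k
    <= ((2 * (max_const * k)).+1 * k.+1 ^ n)%:R.
Proof.
have -> : (\sum_(i < n) ((a i)%:R : R)^-1) ^+ k =
          \sum_(w : word) ((word_slope (codom w))%:R : R)^-1.
  (* Expanding the power gives one term per function from positions to letters, that is, per
     word. *)
  rewrite -[in LHS](card_ord k) -prodr_const bigA_distr_bigA /=.
  apply: eq_bigr => w _.
  by rewrite /word_slope natr_prod big_image /= prodfV.
(* A class of words with equal letter counts has a single slope [A] and at most [(2 M k + 1) A]
   members, so it contributes at most [2 M k + 1]. *)
rewrite (partition_big letter_count predT) //= natrM.
apply: (@le_trans _ _
  (\sum_(m : {ffun 'I_n -> 'I_k.+1}) (2 * (max_const * k)).+1%:R)); last first.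
  by rewrite sumr_const card_ffun !card_ord mulr_natr.
apply: ler_sum => m _.
case: (pickP (fun w => letter_count w == m)) => [w0 /eqP <-|none]; last first.
  by rewrite big_pred0.
rewrite (eq_bigr (fun _ => ((word_slope (codom w0))%:R : R)^-1)); last first.
  move=> w /eqP/letter_count_perm pw.
  by rewrite /word_slope (perm_big _ pw).
rewrite sumr_const -[X in X *+ _]mul1r -mulrnAl.
rewrite ler_pdivrMr ?ltr0n ?word_slope_gt0 // -natrM ler_nat.
by have := card_letter_class w0; rewrite cardsE.
Qed.

End Counting.

End Words.

Lemma word_comp_affine (R : realType) (n : nat) (a : 'I_n -> nat)
    (b : 'I_n -> rat) (f : 'I_n -> R -> R) (D : rat) (c : 'I_n -> int)
    (w : seq 'I_n) (x : R) :
  (forall i x, f i x = (a i)%:R * x + ratr (b i)) ->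
  (forall i, b i * D = (c i)%:~R) ->
  word_comp f w x * ratr D
    = (word_slope a w)%:R * x * ratr D + (word_const a c w)%:~R.
Proof.
move=> hf hb; rewrite /word_slope; elim: w => [|i w IH] /=.
  by rewrite big_nil mul1r addr0.
rewrite big_cons hf mulrDl -mulrA IH -rmorphM /= hb ratr_int.
rewrite mulrDr natrM intrD intrM -pmulrn !mulrA -addrA; congr (_ + _).
exact: addrC.
Qed.

Lemma gen_semigroup_word (T : Type) (n : nat) (f : 'I_n -> T -> T) i w :
  gen_semigroup f (word_comp f (i :: w)).
Proof.
elim: w i => [|j w IH] i; first exact: (gen_semigroup_gen f i).
exact: gen_semigroup_comp (gen_semigroup_gen f i) (IH j).
Qed.

Lemma free_basis_inj (T : Type) (n : nat) (f : 'I_n -> T -> T) s t :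
  free_basis f -> s <> [::] -> t <> [::] ->
  word_comp f s = word_comp f t -> s = t.
Proof.
case: s => // i s fr s0 t0 e.
have [w [_ uw]] := fr _ (gen_semigroup_word f i s).
by rewrite -(uw (i :: s)) // -(uw t).
Qed.

Theorem theorem3 (R : realType) (n : nat) (hn : (1 <= n)%N)
    (a : 'I_n -> nat) (b : 'I_n -> rat) (f : 'I_n -> R -> R)
    (ha : forall i, (0 < a i)%N)
    (hf : forall i x, f i x = (a i)%:R * x + ratr (b i))
    (hsum : \sum_(i < n) ((a i)%:R : R)^-1 > 1) :
  ~ free_basis f /\
  (exists s t : seq 'I_n,
     [/\ s <> [::], t <> [::], s <> t & word_comp f s = word_comp f t]).
Proof.
suff ex : exists s t : seq 'I_n,
    [/\ s <> [::], t <> [::], s <> t & word_comp f s = word_comp f t].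
  split=> // fr; have [s [t [s0 t0 st e]]] := ex.
  exact: st (free_basis_inj fr s0 t0 e).
have [D [c [D0 hb]]] := common_denominator b.
(* The exponent is [n.+1] because [2 M k + 1 <= (2 M + 1) (k + 1)] turns the linear factor into one
   more power of [k + 1]. *)
have [k hk] := exp_gt_poly n.+1 hsum (ler0n R (2 * max_const c).+1).
apply: contrapT => nex.
(* Words that are permutations of each other share their slope, so equal constants make the maps
   equal. *)
have sep (w v : {ffun 'I_k -> 'I_n}) : perm_eq (codom w) (codom v) ->
    word_const a c (codom w) = word_const a c (codom v) -> w = v.
  move=> pwv ewv; apply: contrapT => wv; apply: nex.
  have cwv : codom w <> codom v.
    move=> e; apply: wv; apply: (can_inj fgraphK).
    by apply: val_inj; rewrite /= -!codom_ffun.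
  (* There is only one word of length 0, so two distinct words are nonempty. *)
  have k0 : k <> 0%N.
    by move=> e; apply: wv; apply/ffunP => -[i hi]; exfalso; rewrite e in hi.
  have nnil (u : {ffun 'I_k -> 'I_n}) : codom u <> [::].
    by move=> /(congr1 size); rewrite size_word.
  exists (codom w), (codom v); split=> //; apply/funext => x.
  have RD0 : (ratr D : R) != 0 by rewrite fmorph_eq0.
  apply: (mulIf RD0); rewrite !(word_comp_affine _ _ hf hb) ewv.
  by rewrite /word_slope (perm_big _ pwv).
have := lt_le_trans hk (separated_growth ha sep R).
rewrite -natrX -natrM ltr_nat ltnNge => /negP; apply.
by rewrite expnS [leqRHS]mulnA leq_mul //; nia.
Qed.
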